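(* Let $S=\mathbb{Z}\langle f,s,g\mid fg, fsg, fs^2g,\dots\rangle$ be the quotient of the free (non-commutative, unital) ring $\mathbb{Z}\langle f,s,g\rangle$ by the two-sided ideal generated by $\{fs^ig\mid i=0,1,2,\dots\}$. Then the group homomorphism $$\widehat{\mathrm{ch}}_x:\widetilde{\mathrm{End}}_0(S)\to K_1(S[[x]]),\qquad [S^n,\alpha]\mapsto[1-\alpha x],$$ is not injective.
   Context: Rings are associative with $1$, not necessarily commutative. For a ring $A$, the reduced endomorphism class group $\widetilde{\mathrm{End}}_0(A)$ is the abelian group with one generator $[A^n,\alpha]$ for each isomorphism class of pairs $(A^n,\alpha)$, where $A^n$ is a finitely generated free left $A$-module and $\alpha:A^n\to A^n$ is an $A$-module endomorphism, subject to the relations: (1) $[A^n,\alpha]+[A^{n''},\alpha'']=[A^{n'},\alpha']$ for each exact sequence of $A$-modules $0\to A^n\xrightarrow{\theta}A^{n'}\xrightarrow{\theta'}A^{n''}\to0$ such that $\theta\alpha=\alpha'\theta$ and $\theta'\alpha'=\alpha''\theta'$; (2) $[A^n,0]=0$ for each $n$. (An isomorphism $(A^n,\alpha)\cong(A^{n'},\alpha')$ is a module isomorphism $\theta$ with $\theta\alpha=\alpha'\theta$.) $A[[x]]$ denotes the ring of formal power series in a central indeterminate $x$. $K_1(R)=\mathrm{GL}(R)^{\mathrm{ab}}=\mathrm{GL}(R)/E(R)$ denotes the Whitehead group of a ring $R$, where $\mathrm{GL}(R)=\varinjlim\mathrm{GL}_n(R)$ and $E(R)$ is the subgroup generated by elementary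 matrices; equivalently it is generated by classes of automorphisms of finitely generated projective $R$-modules. For an endomorphism $\alpha:A^n\to A^n$, the map $1-\alpha x:A[[x]]^n\to A[[x]]^n$ is an automorphism with inverse $1+\alpha x+\alpha^2x^2+\cdots$, so it represents an element $[1-\alpha x]\in K_1(A[[x]])$. The assignment $\widehat{\mathrm{ch}}_x[A^n,\alpha]=[1-\alpha x]$ is a well-defined group homomorphism $\widetilde{\mathrm{End}}_0(A)\to K_1(A[[x]])$ (the generalized characteristic polynomial). *)

(* Defs.v *)
From HB Require Import structures.
From mathcomp Require Import all_boot all_order all_algebra.
From mathcomp Require Import finmap.
From mathcomp Require Import boolp.
From mathcomp.multinomials Require Import monalg.

Set Implicit Arguments.
Unset Strict Implicit.
Unset Printing Implicit Defensive.

Import GRing.Theory.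
Local Open Scope ring_scope.
Local Open Scope quotient_scope.

Record pseries (A : pzRingType) := PSeries { pcoef : nat -> A }.

Section PowerSeries.
Variable A : pzRingType.

HB.instance Definition _ := gen_eqMixin (pseries A).
HB.instance Definition _ := gen_choiceMixin (pseries A).

Lemma pseriesP (p q : pseries A) : pcoef p =1 pcoef q -> p = q.
Proof. by case: p q => [p] [q] /= /funext ->. Qed.

Definition ps_zero : pseries A := PSeries (fun=> 0).
Definition ps_opp (p : pseries A) := PSeries (fun n => - pcoef p n).
Definition ps_add (p q : pseries A) := PSeries (fun n => pcoef p n + pcoef q n).
Definition ps_one : pseries A := PSeries (fun n => (n == 0%N)%:R).
Definition ps_mul (p q : pseries A) :=
  PSeries (fun n => \sum_(i < n.+1) pcoef p i * pcoef q (n - i)).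

Fact ps_addA : associative ps_add.
Proof. by move=> p q r; apply: pseriesP => n /=; rewrite addrA. Qed.
Fact ps_addC : commutative ps_add.
Proof. by move=> p q; apply: pseriesP => n /=; rewrite addrC. Qed.
Fact ps_add0 : left_id ps_zero ps_add.
Proof. by move=> p; apply: pseriesP => n /=; rewrite add0r. Qed.
Fact ps_addN : left_inverse ps_zero ps_opp ps_add.
Proof. by move=> p; apply: pseriesP => n /=; rewrite addNr. Qed.

HB.instance Definition _ :=
  GRing.isZmodule.Build (pseries A) ps_addA ps_addC ps_add0 ps_addN.

Fact ps_mulE_rev p q n : pcoef (ps_mul p q) n =
  \sum_(i < n.+1) pcoef p (n - i) * pcoef q i.
Proof.
rewrite /= (reindex_inj rev_ord_inj) /=.
by apply: eq_bigr => i _; rewrite subSS subKn // -ltnS.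
Qed.

Fact ps_mulA : associative ps_mul.
Proof.
move=> p q r; apply: pseriesP => n; rewrite [RHS]ps_mulE_rev.
change (\sum_(i < n.+1) pcoef p i * pcoef (ps_mul q r) (n - i) =
  \sum_(i < n.+1) pcoef (ps_mul p q) (n - i) * pcoef r i).
pose F j i := pcoef p i * (pcoef q (n - i - j)%N * pcoef r j).
transitivity (\sum_(i < n.+1) \sum_(j < n.+1 | (j <= n - i)%N) F j i).
  apply: eq_bigr => i _; rewrite ps_mulE_rev big_distrr /=.
  by rewrite (big_ord_narrow_leq (leq_subr _ _)).
rewrite (exchange_big_dep predT) //=; apply: eq_bigr => j _.
transitivity (\sum_(i < n.+1 | (i <= n - j)%N) F j i).
  apply: eq_bigl => i; rewrite -ltnS -(ltnS i) -!subSn ?leq_ord //.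
  by rewrite -subn_gt0 -(subn_gt0 i) -!subnDA addnC.
rewrite (big_ord_narrow_leq (leq_subr _ _)) big_distrl /=.
by apply: eq_bigr => i _; rewrite /F -!subnDA addnC mulrA.
Qed.

Fact ps_mul1 : left_id ps_one ps_mul.
Proof.
move=> p; apply: pseriesP => n /=; rewrite big_ord_recl /= subn0 mul1r.
by rewrite big1 ?addr0 // => i _; rewrite mul0r.
Qed.
Fact ps_mulr1 : right_id ps_one ps_mul.
Proof.
move=> p; apply: pseriesP => n; rewrite ps_mulE_rev big_ord_recl /= subn0 mulr1.
by rewrite big1 ?addr0 // => i _; rewrite mulr0.
Qed.
Fact ps_mulDl : left_distributive ps_mul +%R.
Proof.
move=> p q r; apply: pseriesP => n /=; rewrite -big_split /=.
by apply: eq_bigr => i _; rewrite mulrDl.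
Qed.
Fact ps_mulDr : right_distributive ps_mul +%R.
Proof.
move=> p q r; apply: pseriesP => n /=; rewrite -big_split /=.
by apply: eq_bigr => i _; rewrite mulrDr.
Qed.

HB.instance Definition _ := GRing.Zmodule_isPzRing.Build (pseries A)
  ps_mulA ps_mul1 ps_mulr1 ps_mulDl ps_mulDr.

Lemma pcoefM (p q : pseries A) n :
  pcoef (p * q) n = \sum_(i < n.+1) pcoef p i * pcoef q (n - i).
Proof. by []. Qed.

Lemma pcoef_sum (I : finType) (F : I -> pseries A) n :
  pcoef (\sum_i F i) n = \sum_i pcoef (F i) n.
Proof. by elim/big_rec2: _ => // i a p _ <-. Qed.

Definition pcst (a : A) : pseries A := PSeries (fun n => a *+ (n == 0%N)).
Definition pX : pseries A := PSeries (fun n => (n == 1%N)%:R).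

Lemma pcoef_pcstM a p n : pcoef (pcst a * p) n = a * pcoef p n.
Proof.
rewrite pcoefM big_ord_recl /= mulr1n subn0.
by rewrite big1 ?addr0 // => i _; rewrite mulr0n mul0r.
Qed.

Lemma pcoef_pXM p n : pcoef (pX * p) n = if n is m.+1 then pcoef p m else 0.
Proof.
rewrite pcoefM; case: n => [|n]; first by rewrite big_ord1 mul0r.
rewrite big_ord_recl mul0r add0r big_ord_recl mul1r subSS subn0.
by rewrite big1 ?addr0 // => i _; rewrite mul0r.
Qed.

Lemma pXC p : pX * p = p * pX.
Proof.
apply: pseriesP => n; rewrite pcoef_pXM [RHS]ps_mulE_rev.
case: n => [|n]; first by rewrite big_ord1 mulr0.
rewrite big_ord_recl mulr0 add0r big_ord_recl mulr1 subSS subn0.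
by rewrite big1 ?addr0 // => i _; rewrite mulr0.
Qed.

Fact pcst_is_zmod_morphism : zmod_morphism pcst.
Proof. by move=> a b; apply: pseriesP => n /=; rewrite mulrnBl. Qed.
Fact pcst_is_monoid_morphism : monoid_morphism pcst.
Proof.
split=> [|a b]; apply: pseriesP => n //.
by rewrite pcoef_pcstM /= mulrnAr.
Qed.
HB.instance Definition _ :=
  GRing.isZmodMorphism.Build A (pseries A) pcst pcst_is_zmod_morphism.
HB.instance Definition _ :=
  GRing.isMonoidMorphism.Build A (pseries A) pcst pcst_is_monoid_morphism.

End PowerSeries.

Arguments pX {A}.

Section IdealQuotient.
Variables (R : pzRingType) (X : R -> Prop).

Inductive ideal_gen : R -> Prop :=
| ideal_gen_in x : X x -> ideal_gen x
| ideal_gen0 : ideal_gen 0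
| ideal_genB x y : ideal_gen x -> ideal_gen y -> ideal_gen (x - y)
| ideal_genMl a x : ideal_gen x -> ideal_gen (a * x)
| ideal_genMr a x : ideal_gen x -> ideal_gen (x * a).

Definition ideal_pred : {pred R} := fun x => `[< ideal_gen x >].

Fact ideal_pred_zmod_closed : zmod_closed ideal_pred.
Proof.
split; first exact/asboolP/ideal_gen0.
by move=> x y /asboolP hx /asboolP hy; apply/asboolP/ideal_genB.
Qed.
HB.instance Definition _ :=
  GRing.isZmodClosed.Build R ideal_pred ideal_pred_zmod_closed.

Definition ring_quot := Quotient.quot ideal_pred.
HB.instance Definition _ := GRing.Zmodule.on ring_quot.
HB.instance Definition _ := EqQuotient.on ring_quot.

Definition rq_pi (x : R) : ring_quot := \pi_ring_quot x.

Lemma rq_piP x y : rq_pi x = rq_pi y <-> ideal_gen (x - y).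
Proof.
have E : (rq_pi x == rq_pi y) = `[< ideal_gen (x - y) >].
  exact/esym/(Quotient.idealrBE ideal_pred).
by split=> [/eqP|h]; [rewrite E => /asboolP | apply/eqP; rewrite E; apply/asboolP].
Qed.

Definition rq_mul (x y : ring_quot) := rq_pi (repr x * repr y).

Fact rq_piM x y : rq_mul (rq_pi x) (rq_pi y) = rq_pi (x * y).
Proof.
apply/rq_piP; set x' := repr _; set y' := repr _.
have hx : ideal_gen (x' - x) by apply/rq_piP; rewrite /rq_pi reprK.
have hy : ideal_gen (y' - y) by apply/rq_piP; rewrite /rq_pi reprK.
have -> : x' * y' - x * y = (x' - x) * y' - x * (y - y').
  by rewrite mulrBl mulrBr opprB addrA subrK.
apply: ideal_genB; first exact: ideal_genMr.
by apply: ideal_genMl; rewrite -opprB -sub0r; apply: ideal_genB => //; apply: ideal_gen0.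
Qed.

Fact rq_piD x y : rq_pi (x + y) = rq_pi x + rq_pi y.
Proof. exact: (raddfD \pi_(Quotient.quot ideal_pred)). Qed.

Fact rq_ind (P : ring_quot -> Prop) : (forall x, P (rq_pi x)) -> forall x, P x.
Proof. by move=> h x; rewrite -[x]reprK; apply: h. Qed.

Fact rq_mulA : associative rq_mul.
Proof.
by elim/rq_ind=> x; elim/rq_ind=> y; elim/rq_ind=> z; rewrite !rq_piM mulrA.
Qed.
Fact rq_mul1 : left_id (rq_pi 1) rq_mul.
Proof. by elim/rq_ind=> x; rewrite rq_piM mul1r. Qed.
Fact rq_mulr1 : right_id (rq_pi 1) rq_mul.
Proof. by elim/rq_ind=> x; rewrite rq_piM mulr1. Qed.
Fact rq_mulDl : left_distributive rq_mul +%R.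
Proof.
elim/rq_ind=> x; elim/rq_ind=> y; elim/rq_ind=> z.
by rewrite -rq_piD !rq_piM -rq_piD mulrDl.
Qed.
Fact rq_mulDr : right_distributive rq_mul +%R.
Proof.
elim/rq_ind=> x; elim/rq_ind=> y; elim/rq_ind=> z.
by rewrite -rq_piD !rq_piM -rq_piD mulrDr.
Qed.

HB.instance Definition _ := GRing.Zmodule_isPzRing.Build ring_quot
  rq_mulA rq_mul1 rq_mulr1 rq_mulDl rq_mulDr.

Fact rq_pi_is_zmod_morphism : zmod_morphism rq_pi.
Proof. exact: (raddfB \pi_(Quotient.quot ideal_pred)). Qed.
Fact rq_pi_is_monoid_morphism : monoid_morphism rq_pi.
Proof. by split=> // x y; rewrite -rq_piM. Qed.
HB.instance Definition _ :=
  GRing.isZmodMorphism.Build R ring_quot rq_pi rq_pi_is_zmod_morphism.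
HB.instance Definition _ :=
  GRing.isMonoidMorphism.Build R ring_quot rq_pi rq_pi_is_monoid_morphism.

End IdealQuotient.

(* [{fmonom I}] is the free (non-commutative) monoid on [I], so its monoid ring
   over [int] is the free ring on the letters f, s, g. *)
Definition free_ring3 := {malg int[{fmonom 'I_3}]}.

Definition letter (i : 'I_3) : free_ring3 := << fmu i >>.
Definition free_f : free_ring3 := letter (@Ordinal 3 0 isT).
Definition free_s : free_ring3 := letter (@Ordinal 3 1 isT).
Definition free_g : free_ring3 := letter (@Ordinal 3 2 isT).

Definition S_relator (w : free_ring3) : Prop :=
  exists i : nat, w = free_f * free_s ^+ i * free_g.

Definition Sring : pzRingType := ring_quot S_relator.

(* G^ab, written additively. *)
Section Abelianization.
Local Open Scope group_scope.
Variable G : groupType.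

Inductive derived : G -> Prop :=
| derived_comm x y : derived [~ x, y]
| derived1 : derived 1
| derivedM x y : derived x -> derived y -> derived (x * y)
| derivedV x : derived x -> derived x^-1.

Fact derivedJ x d : derived d -> derived (x * d * x^-1).
Proof.
move=> dd; have -> : x * d * x^-1 = [~ x^-1, d^-1] * d.
  by rewrite /commg /conjg !invgK !mulgA mulgVK.
by apply: derivedM => //; apply: derived_comm.
Qed.

Definition ab_rel : rel G := fun x y => `[< derived (x / y) >].

Fact ab_rel_refl : reflexive ab_rel.
Proof. by move=> x; apply/asboolP; rewrite mulgV; apply: derived1. Qed.
Fact ab_rel_sym : symmetric ab_rel.
Proof.
have h x y : ab_rel x y -> ab_rel y x.
  by move/asboolP=> d; apply/asboolP; rewrite -invgF; apply: derivedV.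
by move=> x y; apply/idP/idP; apply: h.
Qed.
Fact ab_rel_trans : transitive ab_rel.
Proof.
move=> y x z /asboolP h1 /asboolP h2; apply/asboolP.
by rewrite -(mulgVK y x) -mulgA; apply: derivedM.
Qed.

Canonical ab_equiv := EquivRel ab_rel ab_rel_refl ab_rel_sym ab_rel_trans.
Definition abelianization := {eq_quot ab_rel}.
HB.instance Definition _ := EqQuotient.on abelianization.
HB.instance Definition _ := Choice.on abelianization.

Definition ab_pi (x : G) : abelianization := \pi_abelianization x.

Lemma ab_piP x y : ab_pi x = ab_pi y <-> derived (x / y).
Proof.
split=> [/eqP|h]; last by apply/eqP; rewrite /ab_pi eqmodE; apply/asboolP.
by rewrite /ab_pi eqmodE => /asboolP.
Qed.

Definition ab_add (x y : abelianization) := ab_pi (repr x * repr y).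
Definition ab_opp (x : abelianization) := ab_pi (repr x)^-1.

Fact ab_ind (P : abelianization -> Prop) : (forall x, P (ab_pi x)) -> forall x, P x.
Proof. by move=> h x; rewrite -[x]reprK; apply: h. Qed.

Fact ab_repr x : derived (repr (ab_pi x) / x).
Proof. by apply/ab_piP; rewrite /ab_pi reprK. Qed.

Fact ab_piM_subproof x y : ab_add (ab_pi x) (ab_pi y) = ab_pi (x * y).
Proof.
apply/ab_piP; set x' := repr _; set y' := repr _.
have -> : x' * y' / (x * y) = x' * (y' / y) * x'^-1 * (x' / x).
  by rewrite invgM !mulgA mulgVK.
by apply: derivedM; [apply: derivedJ|]; apply: ab_repr.
Qed.

Fact ab_piC x y : ab_pi (x * y) = ab_pi (y * x).
Proof.
apply/ab_piP; have -> : x * y / (y * x) = [~ x^-1, y^-1]; last exact: derived_comm.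
by rewrite /commg /conjg !invgK invgM !mulgA.
Qed.

Fact ab_piV_subproof x : ab_opp (ab_pi x) = ab_pi x^-1.
Proof.
apply/ab_piP; rewrite invgK; set x' := repr _.
have -> : x'^-1 * x = x'^-1 * (x' / x)^-1 * (x'^-1)^-1.
  by rewrite invgF invgK !mulgA mulgVK.
by apply/derivedJ/derivedV/ab_repr.
Qed.

Fact ab_addA : associative ab_add.
Proof.
by elim/ab_ind=> x; elim/ab_ind=> y; elim/ab_ind=> z; rewrite !ab_piM_subproof mulgA.
Qed.
Fact ab_addC : commutative ab_add.
Proof. by elim/ab_ind=> x; elim/ab_ind=> y; rewrite !ab_piM_subproof ab_piC. Qed.
Fact ab_add0 : left_id (ab_pi 1) ab_add.
Proof. by elim/ab_ind=> x; rewrite ab_piM_subproof mul1g. Qed.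
Fact ab_addN : left_inverse (ab_pi 1) ab_opp ab_add.
Proof. by elim/ab_ind=> x; rewrite ab_piV_subproof ab_piM_subproof mulVg. Qed.

HB.instance Definition _ :=
  GRing.isZmodule.Build abelianization ab_addA ab_addC ab_add0 ab_addN.

Lemma ab_piM x y : ab_pi (x * y) = (ab_pi x + ab_pi y)%R.
Proof. by rewrite -ab_piM_subproof. Qed.
Lemma ab_pi1 : ab_pi 1 = 0%R.
Proof. by []. Qed.

End Abelianization.

Section GeneralLinear.
Variable R : pzRingType.

Definition invertible_mx n (M : 'M[R]_n) : Prop :=
  exists N : 'M[R]_n, M *m N = 1%:M /\ N *m M = 1%:M.

(* The union GL(R) of the GL_n(R) is realised by the infinite matrices that
   extend an invertible n x n block by the identity. *)
Definition infmx n (M : 'M[R]_n) : nat -> nat -> R := fun i j =>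
  match insub i, insub j with
  | Some i', Some j' => M i' j'
  | _, _ => (i == j)%:R
  end.

Definition is_GL (F : nat -> nat -> R) : Prop :=
  exists n (M : 'M[R]_n), invertible_mx M /\ F = infmx M.

Definition GL := {F : nat -> nat -> R | `[< is_GL F >]}.
HB.instance Definition _ := Choice.on GL.

Definition cutmx n (F : nat -> nat -> R) : 'M[R]_n := \matrix_(i, j) F i j.
Definition id_above n (F : nat -> nat -> R) :=
  forall i j, (n <= i)%N || (n <= j)%N -> F i j = (i == j)%:R.

Lemma infmx_in n (M : 'M[R]_n) (i j : 'I_n) : infmx M i j = M i j.
Proof. by rewrite /infmx !valK. Qed.

Lemma infmx_out n (M : 'M[R]_n) : id_above n (infmx M).
Proof.
move=> i j /orP[]h; rewrite /infmx.
  by rewrite (insubN 'I_n (_ : ~~ (i < n)%N)) // -leqNgt.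
rewrite (insubN 'I_n (_ : ~~ (j < n)%N)) -?leqNgt //.
by case: (insub i).
Qed.

Lemma infmxP n (F G : nat -> nat -> R) : id_above n F -> id_above n G ->
  (forall i j : 'I_n, F i j = G i j) -> F = G.
Proof.
move=> hF hG h; apply/funext => i; apply/funext => j.
have [hi|hi] := leqP n i; first by rewrite hF ?hG ?hi.
have [hj|hj] := leqP n j; first by rewrite hF ?hG ?hj ?orbT.
exact: (h (Ordinal hi) (Ordinal hj)).
Qed.

Lemma infmxK n (M : 'M[R]_n) : cutmx n (infmx M) = M.
Proof. by apply/matrixP => i j; rewrite mxE infmx_in. Qed.

Lemma cutmxK n F : id_above n F -> infmx (cutmx n F) = F.
Proof.
move=> hF; apply: (infmxP (@infmx_out _ _) hF) => i j.
by rewrite infmx_in mxE.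
Qed.

Lemma id_above_le n m F : (n <= m)%N -> id_above n F -> id_above m F.
Proof.
move=> nm hF i j h; apply: hF.
by case/orP: h => h; rewrite (leq_trans nm h) ?orbT.
Qed.

Lemma infmx1 n : infmx (1%:M : 'M[R]_n) = fun i j => (i == j)%:R.
Proof.
by apply: (@infmxP n) => [|//|i j]; [apply: infmx_out|rewrite infmx_in mxE].
Qed.

Lemma cutmxME n F G (i j : 'I_n) :
  (cutmx n F *m cutmx n G) i j = \sum_(l < n) F i l * G l j.
Proof. by rewrite mxE; apply: eq_bigr => l _; rewrite !mxE. Qed.

Lemma cutmx_idM n m F G : (n <= m)%N -> id_above n F -> id_above n G ->
  infmx (cutmx n F *m cutmx n G) = infmx (cutmx m F *m cutmx m G).
Proof.
move=> nm hF hG; apply: (@infmxP m); last first.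
- move=> i j; rewrite [RHS]infmx_in cutmxME.
  have [hi|hi] := leqP n i.
    rewrite infmx_out ?hi // (bigD1 i) //= hF ?hi // eqxx mul1r hG ?hi //.
    rewrite big1 ?addr0 // => l li; rewrite hF ?hi // (_ : _ == _ = false) ?mul0r //.
    by apply/negbTE; rewrite eq_sym.
  have [hj|hj] := leqP n j.
    rewrite infmx_out ?hj ?orbT // (bigD1 j) //= (hG j j) ?hj // eqxx mulr1 hF ?hj ?orbT //.
    rewrite big1 ?addr0 // => l lj; rewrite hG ?hj ?orbT //.
    by rewrite (_ : _ == _ = false) ?mulr0 //; apply/negbTE.
  rewrite (infmx_in _ (Ordinal hi) (Ordinal hj)) cutmxME.
  rewrite /= (big_ord_widen m (fun l => F i l * G l j) nm) big_mkcond /=.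
  apply: eq_bigr => l _; case: ltnP => // nl.
  rewrite hF ?nl ?orbT // (_ : _ == _ = false) ?mul0r //.
  by apply/negbTE; rewrite neq_ltn (leq_trans hi nl).
- exact: infmx_out.
- exact: id_above_le nm (@infmx_out _ _).
Qed.

Lemma GL_bound (F : GL) : exists n, id_above n (val F).
Proof.
by case: F => F /= /asboolP [n [M [_ ->]]]; exists n; apply: infmx_out.
Qed.

Definition GLbound (F : GL) : nat := sval (cid (GL_bound F)).
Lemma GLboundP F : id_above (GLbound F) (val F).
Proof. exact: svalP (cid (GL_bound F)). Qed.

Lemma GL_cut_inv n (F : GL) : id_above n (val F) -> invertible_mx (cutmx n (val F)).
Proof.
case: F => F /= /asboolP [m [M [[N [MN NM]] ->]]] hn.
have hm := infmx_out M; have hN := infmx_out N.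
have nk : (n <= maxn n m)%N by rewrite leq_maxl.
have mk : (m <= maxn n m)%N by rewrite leq_maxr.
have e1 : cutmx (maxn n m) (infmx M) *m cutmx (maxn n m) (infmx N) = 1%:M.
  rewrite -[LHS]infmxK -(cutmx_idM mk) // !infmxK MN.
  by apply/matrixP => i j; rewrite mxE infmx1 mxE.
have e2 : cutmx (maxn n m) (infmx N) *m cutmx (maxn n m) (infmx M) = 1%:M.
  rewrite -[LHS]infmxK -(cutmx_idM mk) // !infmxK NM.
  by apply/matrixP => i j; rewrite mxE infmx1 mxE.
have hNn : id_above n (infmx N).
  move=> i j hij; have [hk|] := boolP ((maxn n m <= i) || (maxn n m <= j))%N.
    by apply: (id_above_le mk hN).
  rewrite negb_or -!ltnNge => /andP[hi hj].
  have [ni|ni] := leqP n i.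
    move/matrixP/(_ (Ordinal hi) (Ordinal hj)): e1; rewrite !mxE /=.
    rewrite (bigD1 (Ordinal hi)) //= !mxE /= hn ?ni // eqxx mul1r big1 ?addr0 //.
    move=> l li; rewrite !mxE /= hn ?ni // (_ : _ == _ = false) ?mul0r //.
    by apply/negbTE; rewrite eq_sym.
  have nj : (n <= j)%N by move: hij; rewrite leqNgt ni.
  move/matrixP/(_ (Ordinal hi) (Ordinal hj)): e2; rewrite !mxE /=.
  rewrite (bigD1 (Ordinal hj)) //= !mxE /= (hn j j) ?nj // eqxx mulr1 big1 ?addr0 //.
  move=> l lj; rewrite !mxE /= hn ?nj ?orbT // (_ : _ == _ = false) ?mulr0 //.
  exact/negbTE.
exists (cutmx n (infmx N)); split.
  by rewrite -[LHS]infmxK (cutmx_idM nk) // e1 infmx1; apply/matrixP => i j; rewrite !mxE.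
by rewrite -[LHS]infmxK (cutmx_idM nk) // e2 infmx1; apply/matrixP => i j; rewrite !mxE.
Qed.

Lemma invertible_mxM n (M N : 'M[R]_n) :
  invertible_mx M -> invertible_mx N -> invertible_mx (M *m N).
Proof.
move=> [M' [h1 h2]] [N' [h3 h4]]; exists (N' *m M'); split.
  by rewrite mulmxA -(mulmxA M) h3 mulmx1.
by rewrite mulmxA -(mulmxA N') h2 mulmx1.
Qed.

Lemma invertible_mx1 n : invertible_mx (1%:M : 'M[R]_n).
Proof. by exists 1%:M; rewrite mulmx1. Qed.

Lemma is_GL_infmx n (M : 'M[R]_n) : invertible_mx M -> `[< is_GL (infmx M) >].
Proof. by move=> h; apply/asboolP; exists n, M. Qed.

Definition toGL n (M : 'M[R]_n) (iM : invertible_mx M) : GL :=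
  exist _ (infmx M) (is_GL_infmx iM).

Fact GLmul_subproof (F G : GL) :
  invertible_mx (cutmx (maxn (GLbound F) (GLbound G)) (val F) *m
                 cutmx (maxn (GLbound F) (GLbound G)) (val G)).
Proof.
by apply: invertible_mxM; apply: GL_cut_inv;
   apply: id_above_le (@GLboundP _); rewrite (leq_maxl, leq_maxr).
Qed.

Definition GLmul (F G : GL) : GL := toGL (GLmul_subproof F G).
Definition GLone : GL := toGL (invertible_mx1 0).

Lemma GLmulE n F G : id_above n (val F) -> id_above n (val G) ->
  val (GLmul F G) = infmx (cutmx n (val F) *m cutmx n (val G)).
Proof.
move=> hF hG; rewrite /=; set m := maxn _ _.
have hF' : id_above m (val F) by apply: id_above_le (@GLboundP _); rewrite leq_maxl.
have hG' : id_above m (val G) by apply: id_above_le (@GLboundP _); rewrite leq_maxr.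
have [mn|/ltnW nm] := leqP m n; first exact: cutmx_idM.
exact/esym/cutmx_idM.
Qed.

Lemma GL3_bound (F G H : GL) :
  exists n, [/\ id_above n (val F), id_above n (val G) & id_above n (val H)].
Proof.
exists (maxn (GLbound F) (maxn (GLbound G) (GLbound H))).
by split; apply: id_above_le (@GLboundP _); rewrite !leq_max leqnn ?orbT.
Qed.

Fact GLmulA : associative GLmul.
Proof.
move=> F G H; apply: val_inj; have [n [hF hG hH]] := GL3_bound F G H.
have hFG : id_above n (val (GLmul F G)) by rewrite (GLmulE hF hG); apply: infmx_out.
have hGH : id_above n (val (GLmul G H)) by rewrite (GLmulE hG hH); apply: infmx_out.
by rewrite (GLmulE hF hGH) (GLmulE hFG hH) (GLmulE hF hG) (GLmulE hG hH) !infmxK mulmxA.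
Qed.

Lemma GLoneE n : id_above n (val GLone).
Proof. by rewrite /= infmx1. Qed.

Lemma cut_GLone n : cutmx n (val GLone) = 1%:M.
Proof. by rewrite /= infmx1; apply/matrixP => i j; rewrite !mxE. Qed.

Fact GLmul1 : left_id GLone GLmul.
Proof.
move=> F; apply: val_inj; have hF := @GLboundP F.
by rewrite (GLmulE (@GLoneE _) hF) cut_GLone mul1mx cutmxK.
Qed.
Fact GLmulr1 : right_id GLone GLmul.
Proof.
move=> F; apply: val_inj; have hF := @GLboundP F.
by rewrite (GLmulE hF (@GLoneE _)) cut_GLone mulmx1 cutmxK.
Qed.

Fact GL_has_inv (F : GL) : exists G, GLmul G F = GLone /\ GLmul F G = GLone.
Proof.
have hF := @GLboundP F; have [N [FN NF]] := GL_cut_inv hF.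
have iN : invertible_mx N by exists (cutmx (GLbound F) (val F)).
have hN : id_above (GLbound F) (val (toGL iN)) by apply: infmx_out.
exists (toGL iN); split; apply: val_inj.
  by rewrite (GLmulE hN hF) [cutmx _ (val (toGL _))]infmxK NF /= !infmx1.
by rewrite (GLmulE hF hN) [cutmx _ (val (toGL _))]infmxK FN /= !infmx1.
Qed.

Definition GLinv (F : GL) : GL := sval (cid (GL_has_inv F)).
Fact GLmulV : left_inverse GLone GLinv GLmul.
Proof. by move=> F; case: (svalP (cid (GL_has_inv F))). Qed.
Fact GLmulrV : right_inverse GLone GLinv GLmul.
Proof. by move=> F; case: (svalP (cid (GL_has_inv F))). Qed.

HB.instance Definition _ := isGroup.Build GL GLmulA GLmul1 GLmulr1 GLmulV GLmulrV.

Lemma toGL_eq n m (M : 'M[R]_n) (N : 'M[R]_m) (iM : invertible_mx M)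
  (iN : invertible_mx N) : infmx M = infmx N -> toGL iM = toGL iN.
Proof. by move=> e; apply: val_inj. Qed.

Lemma toGLM n (M N : 'M[R]_n) (iM : invertible_mx M) (iN : invertible_mx N)
  (iMN : invertible_mx (M *m N)) : toGL iMN = (toGL iM * toGL iN)%g.
Proof.
apply: val_inj; rewrite (GLmulE (F := toGL iM) (G := toGL iN) (n := n)); first last.
- exact: infmx_out.
- exact: infmx_out.
by rewrite /= !infmxK.
Qed.

Definition K1 : zmodType := abelianization GL.

(* The class [M] of an invertible matrix, i.e. of the automorphism v |-> v M of
   the free left module R^n of row vectors. *)
Definition K1_class n (M : 'M[R]_n) (iM : invertible_mx M) : K1 := ab_pi (toGL iM).

End GeneralLinear.

Section K1Theory.
Variable R : pzRingType.

Lemma K1_class_inf n m (M : 'M[R]_n) (N : 'M[R]_m) (iM : invertible_mx M)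
  (iN : invertible_mx N) : infmx M = infmx N -> K1_class iM = K1_class iN.
Proof. by move=> e; congr ab_pi; apply: toGL_eq. Qed.

Lemma K1_classM n (M N : 'M[R]_n) (iM : invertible_mx M) (iN : invertible_mx N)
  (iMN : invertible_mx (M *m N)) : K1_class iMN = K1_class iM + K1_class iN.
Proof. by rewrite /K1_class (toGLM iM iN) ab_piM. Qed.

Lemma K1_class_id n (i1 : invertible_mx (1%:M : 'M[R]_n)) : K1_class i1 = 0.
Proof. by rewrite -ab_pi1; congr ab_pi; apply: val_inj; rewrite /= !infmx1. Qed.

Lemma K1_class_conj n m (P : 'M[R]_(n, m)) (Q : 'M[R]_(m, n)) (M : 'M[R]_n)
    (iM : invertible_mx M) (iN : invertible_mx (Q *m M *m P)) :
  n = m -> P *m Q = 1%:M -> Q *m P = 1%:M -> K1_class iN = K1_class iM.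
Proof.
move=> e; case: m / e P Q iN => P Q iN PQ QP.
have iP : invertible_mx P by exists Q.
have iQ : invertible_mx Q by exists P.
rewrite (K1_classM (invertible_mxM iQ iM) iP) (K1_classM iQ iM).
rewrite addrAC -[RHS]add0r; congr (_ + _).
rewrite -(K1_classM iQ iP (invertible_mxM iQ iP)) -(K1_class_id (invertible_mx1 R n)).
by apply: K1_class_inf; rewrite QP.
Qed.

Lemma infmx_block1 n k (M : 'M[R]_n) :
  infmx (block_mx M 0 0 (1%:M : 'M_k)) = infmx M.
Proof.
apply: (@infmxP _ (n + k)); first exact: infmx_out.
  exact: id_above_le (leq_addr _ _) (@infmx_out _ _ M).
move=> i j; rewrite infmx_in.
case: (split_ordP i) => i' ->; case: (split_ordP j) => j' ->.
- by rewrite block_mxEul -infmx_in.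
- rewrite block_mxEur mxE infmx_out /= ?leq_addr ?orbT //.
  by rewrite ltn_eqF // (leq_trans (ltn_ord _) (leq_addr _ _)).
- rewrite block_mxEdl mxE infmx_out /= ?leq_addr ?orbT //.
  by rewrite gtn_eqF // (leq_trans (ltn_ord _) (leq_addr _ _)).
- by rewrite block_mxEdr mxE infmx_out /= ?leq_addr ?orbT // eqn_add2l.
Qed.

Lemma block1_inv n k (M : 'M[R]_n) :
  invertible_mx M -> invertible_mx (block_mx M 0 0 (1%:M : 'M_k)).
Proof.
move=> [N [MN NM]]; exists (block_mx N 0 0 1%:M).
by rewrite !mulmx_block !mulmx0 !mul0mx !addr0 !add0r !mul1mx MN NM -scalar_mx_block.
Qed.

Lemma K1_class_1block n k (M : 'M[R]_k) (iM : invertible_mx M)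
    (iN : invertible_mx (block_mx (1%:M : 'M_n) 0 0 M)) :
  K1_class iN = K1_class iM.
Proof.
have i1 := block1_inv n iM.
rewrite -(K1_class_inf i1 iM (infmx_block1 n M)).
pose P : 'M[R]_(k + n, n + k) := block_mx 0 1%:M 1%:M 0.
pose Q : 'M[R]_(n + k, k + n) := block_mx 0 1%:M 1%:M 0.
have PQ : P *m Q = 1%:M.
  by rewrite mulmx_block !mulmx0 !mul0mx !addr0 !add0r !mul1mx -scalar_mx_block.
have QP : Q *m P = 1%:M.
  by rewrite mulmx_block !mulmx0 !mul0mx !addr0 !add0r !mul1mx -scalar_mx_block.
have e : Q *m block_mx M 0 0 1%:M *m P = block_mx 1%:M 0 0 M.
  rewrite !mulmx_block !(mulmx0, mul0mx, addr0, add0r, mul1mx, mulmx1).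
  by [].
have iN' : invertible_mx (Q *m block_mx M 0 0 1%:M *m P) by rewrite e.
rewrite -(K1_class_conj i1 iN' (addnC _ _) PQ QP).
by apply: K1_class_inf; rewrite e.
Qed.

(* Conjugation by a rectangular isomorphism: R need not have the invariant basis
   number property, so n and m may differ. *)
Lemma K1_class_iso n m (P : 'M[R]_(n, m)) (Q : 'M[R]_(m, n)) (M : 'M[R]_n)
    (iM : invertible_mx M) (iN : invertible_mx (Q *m M *m P)) :
  P *m Q = 1%:M -> Q *m P = 1%:M -> K1_class iN = K1_class iM.
Proof.
move=> PQ QP; pose W : 'M[R]_(n + m) := block_mx 0 P Q 0.
have WW : W *m W = 1%:M.
  by rewrite mulmx_block !mulmx0 !mul0mx !addr0 !add0r PQ QP -scalar_mx_block.
have i1 := block1_inv m iM.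
have e : W *m block_mx M 0 0 1%:M *m W = block_mx 1%:M 0 0 (Q *m M *m P).
  by rewrite !mulmx_block !(mulmx0, mul0mx, addr0, add0r, mul1mx, mulmx1) PQ.
have i2 : invertible_mx (W *m block_mx M 0 0 1%:M *m W).
  by apply: invertible_mxM; [apply: invertible_mxM|] => //; exists W.
have i3 : invertible_mx (block_mx (1%:M : 'M_n) 0 0 (Q *m M *m P)) by rewrite -e.
rewrite -(K1_class_1block iN i3) -(K1_class_inf i1 iM (infmx_block1 _ _)).
rewrite -(K1_class_conj i1 i2 erefl WW WW).
by apply: K1_class_inf; rewrite e.
Qed.

Lemma K1_class_unip n m (X : 'M[R]_(m, n))
    (iX : invertible_mx (block_mx (1%:M : 'M_n) 0 X (1%:M : 'M_m))) :
  K1_class iX = 0.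
Proof.
pose a : 'M[R]_((n + m) + m) := block_mx 1%:M (col_mx 0 1%:M) 0 1%:M.
pose a' : 'M[R]_((n + m) + m) := block_mx 1%:M (- col_mx 0 1%:M) 0 1%:M.
pose b : 'M[R]_((n + m) + m) := block_mx 1%:M 0 (row_mx X 0) 1%:M.
pose b' : 'M[R]_((n + m) + m) := block_mx 1%:M 0 (- row_mx X 0) 1%:M.
have ia : invertible_mx a.
  by exists a'; rewrite !mulmx_block !(mulmx0, mul0mx, addr0, add0r, mul1mx, mulmx1)
     addrN addNr -scalar_mx_block.
have ib : invertible_mx b.
  by exists b'; rewrite !mulmx_block !(mulmx0, mul0mx, addr0, add0r, mul1mx, mulmx1)
     addrN addNr -scalar_mx_block.
have ie := block1_inv m iX.
have E : a *m b = block_mx (block_mx 1%:M 0 X 1%:M) 0 0 1%:M *m (b *m a).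
  rewrite !mulmx_block !(mulmx0, mul0mx, addr0, add0r, mul1mx, mulmx1).
  rewrite mul_col_row mul_block_col !(mulmx0, mul0mx, mul1mx, mulmx1, addr0, add0r).
  by rewrite mul_row_col mulmx0 mul0mx scalar_mx_block add_block_mx !(addr0, add0r).
rewrite -(K1_class_inf ie iX (infmx_block1 _ _)).
have iab := invertible_mxM ia ib; have iba := invertible_mxM ib ia.
have ieba := invertible_mxM ie iba.
have h : K1_class iab = K1_class ieba by apply: K1_class_inf; rewrite E.
move: h; rewrite (K1_classM ie iba) (K1_classM ia ib) (K1_classM ib ia).
by rewrite addrC -[LHS]add0r => /addIr.
Qed.

Lemma K1_class_lblock n m (M : 'M[R]_n) (N : 'M[R]_m) (C : 'M[R]_(m, n))
    (iM : invertible_mx M) (iN : invertible_mx N)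
    (iB : invertible_mx (block_mx M 0 C N)) :
  K1_class iB = K1_class iM + K1_class iN.
Proof.
have [M' [MM' M'M]] := iM.
have iX : invertible_mx (block_mx (1%:M : 'M_n) 0 (C *m M') (1%:M : 'M_m)).
  exists (block_mx 1%:M 0 (- (C *m M')) 1%:M).
  by rewrite !mulmx_block !(mulmx0, mul0mx, addr0, add0r, mul1mx, mulmx1)
     addrN addNr -scalar_mx_block.
have i1 := block1_inv m iM.
have i2 : invertible_mx (block_mx (1%:M : 'M_n) 0 0 N).
  have [N' [NN' N'N]] := iN; exists (block_mx 1%:M 0 0 N').
  by rewrite !mulmx_block !(mulmx0, mul0mx, addr0, add0r, mul1mx, mulmx1)
     NN' N'N -scalar_mx_block.
have i12 := invertible_mxM i1 i2; have i := invertible_mxM iX i12.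
have -> : K1_class iB = K1_class i.
  apply: K1_class_inf; congr infmx.
  rewrite !mulmx_block !(mulmx0, mul0mx, addr0, add0r, mul1mx, mulmx1).
  by rewrite -mulmxA M'M mulmx1.
rewrite (K1_classM iX i12) K1_class_unip add0r (K1_classM i1 i2).
by rewrite (K1_class_inf i1 iM (infmx_block1 _ _)) (K1_class_1block iN).
Qed.

End K1Theory.

Section ZmodQuotient.
Variables (V : zmodType) (X : V -> Prop).

Inductive zmod_gen : V -> Prop :=
| zmod_gen_in x : X x -> zmod_gen x
| zmod_gen0 : zmod_gen 0
| zmod_genB x y : zmod_gen x -> zmod_gen y -> zmod_gen (x - y).

Definition zmod_gen_pred : {pred V} := fun x => `[< zmod_gen x >].

Fact zmod_gen_pred_zmod_closed : zmod_closed zmod_gen_pred.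
Proof.
split; first exact/asboolP/zmod_gen0.
by move=> x y /asboolP hx /asboolP hy; apply/asboolP/zmod_genB.
Qed.
HB.instance Definition _ :=
  GRing.isZmodClosed.Build V zmod_gen_pred zmod_gen_pred_zmod_closed.

Definition zmod_quot := Quotient.quot zmod_gen_pred.
HB.instance Definition _ := GRing.Zmodule.on zmod_quot.
HB.instance Definition _ := EqQuotient.on zmod_quot.

Definition zq_pi (x : V) : zmod_quot := \pi_zmod_quot x.

Lemma zq_piP x y : zq_pi x = zq_pi y <-> zmod_gen (x - y).
Proof.
have E : (zq_pi x == zq_pi y) = `[< zmod_gen (x - y) >].
  exact/esym/(Quotient.idealrBE zmod_gen_pred).
by split=> [/eqP|h]; [rewrite E => /asboolP | apply/eqP; rewrite E; apply/asboolP].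
Qed.

Fact zq_pi_is_zmod_morphism : zmod_morphism zq_pi.
Proof. exact: (raddfB \pi_(Quotient.quot zmod_gen_pred)). Qed.
HB.instance Definition _ :=
  GRing.isZmodMorphism.Build V zmod_quot zq_pi zq_pi_is_zmod_morphism.

End ZmodQuotient.

Section ZmodQuotientLift.
Variables (V : zmodType) (X : V -> Prop) (W : zmodType) (h : {additive V -> W}).
Hypothesis hX : forall x, X x -> h x = 0.

Fact zmod_gen_ker x : zmod_gen X x -> h x = 0.
Proof. by elim=> [|| ? ? _ e1 _ e2]; rewrite ?raddf0 // raddfB e1 e2 subrr. Qed.

Definition zq_lift (x : zmod_quot X) : W := h (repr x).

Lemma zq_lift_pi x : zq_lift (zq_pi X x) = h x.
Proof.
apply/eqP; rewrite -subr_eq0 -raddfB; apply/eqP/zmod_gen_ker.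
by apply/zq_piP; rewrite /zq_pi reprK.
Qed.

Lemma zq_lift_is_zmod_morphism : zmod_morphism zq_lift.
Proof.
move=> x y; rewrite -[x]reprK -[y]reprK -!/(zq_pi X _) -raddfB !zq_lift_pi.
exact: raddfB.
Qed.

End ZmodQuotientLift.

Section FreeLift.
Variables (K : choiceType) (W : zmodType) (f : K -> W).

Definition free_lift (u : {malg int[K]}) : W := \sum_(k <- msupp u) f k *~ u@_k.

Lemma free_liftEw (d : {fset K}) u : (msupp u `<=` d)%fset ->
  free_lift u = \sum_(k <- d) f k *~ u@_k.
Proof.
move=> le; rewrite [LHS](big_fset_incl _ le) => //= x xd /mcoeff_outdom ->.
by rewrite mulr0z.
Qed.

Lemma free_liftU k : free_lift << k >> = f k.
Proof. by rewrite (free_liftEw msuppU_le) big_seq_fset1 mcoeffUU mulr1z. Qed.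

Fact free_lift_is_zmod_morphism : zmod_morphism free_lift.
Proof.
move=> u v; set d := (msupp u `|` msupp v)%fset.
rewrite (@free_liftEw d) ?msuppB_le // (@free_liftEw d u) ?fsubsetUl //.
rewrite (@free_liftEw d v) ?fsubsetUr // -sumrB.
by apply: eq_bigr => k _; rewrite mcoeffB mulrzBr.
Qed.
HB.instance Definition _ :=
  GRing.isZmodMorphism.Build {malg int[K]} W free_lift free_lift_is_zmod_morphism.

End FreeLift.

Section EndZero.
Variable A : pzRingType.

(* A pair (A^n, alpha): the free left module A^n is the module of row vectors and
   the matrix alpha stands for the endomorphism v |-> v *m alpha. Hence the
   composite map "first alpha, then theta" has matrix [alpha *m theta]. *)
Definition endo := {n : nat & 'M[A]_n}.
HB.instance Definition _ := Choice.on endo.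

Definition Endo n (alpha : 'M[A]_n) : endo := Tagged (fun n => 'M[A]_n) alpha.

Definition rmul_mx n m (theta : 'M[A]_(n, m)) (v : 'rV[A]_n) : 'rV[A]_m := v *m theta.

Definition endo_iso n n' (alpha : 'M[A]_n) (alpha' : 'M[A]_n')
    (theta : 'M[A]_(n, n')) : Prop :=
  bijective (rmul_mx theta) /\ alpha *m theta = theta *m alpha'.

Definition short_exact n n' n'' (theta : 'M[A]_(n, n')) (theta' : 'M[A]_(n', n''))
    : Prop :=
  [/\ injective (rmul_mx theta),
      forall v, rmul_mx theta' v = 0 <-> exists u, rmul_mx theta u = v &
      forall w, exists v, rmul_mx theta' v = w].

Inductive End0_rel : {malg int[endo]} -> Prop :=
| End0_iso n n' (alpha : 'M[A]_n) (alpha' : 'M[A]_n') (theta : 'M[A]_(n, n')) :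
    endo_iso alpha alpha' theta ->
    End0_rel (<< Endo alpha >> - << Endo alpha' >>)
| End0_exact n n' n'' (alpha : 'M[A]_n) (alpha' : 'M[A]_n') (alpha'' : 'M[A]_n'')
    (theta : 'M[A]_(n, n')) (theta' : 'M[A]_(n', n'')) :
    short_exact theta theta' ->
    alpha *m theta = theta *m alpha' -> alpha' *m theta' = theta' *m alpha'' ->
    End0_rel (<< Endo alpha >> + << Endo alpha'' >> - << Endo alpha' >>)
| End0_zero n : End0_rel << Endo (0 : 'M[A]_n) >>.

Definition End0 : zmodType := zmod_quot End0_rel.
Definition End0_class n (alpha : 'M[A]_n) : End0 := zq_pi End0_rel << Endo alpha >>.

End EndZero.

Section Characteristic.
Variable A : pzRingType.

Definition one_sub_x n (alpha : 'M[A]_n) : 'M[pseries A]_n :=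
  1%:M - map_mx (fun a => pcst a * pX) alpha.

Definition geom_mx n (alpha : 'M[A]_n) : 'M[pseries A]_n :=
  \matrix_(i, j) PSeries (fun k => iter k (mulmx alpha) 1%:M i j).

Lemma one_sub_x_geom n (alpha : 'M[A]_n) :
  one_sub_x alpha *m geom_mx alpha = 1%:M /\ geom_mx alpha *m one_sub_x alpha = 1%:M.
Proof.
have iterC k : iter k (mulmx alpha) 1%:M *m alpha = iter k.+1 (mulmx alpha) 1%:M.
  by elim: k => [|k IH]; rewrite ?mul1mx /= ?mulmx1 // -mulmxA IH.
have c1 (i j : 'I_n) k : pcoef ((1%:M : 'M[pseries A]_n) i j) k
    = (if k is 0%N then 1%:M else 0 : 'M[A]_n) i j.
  by case: k => [|k]; rewrite !mxE; case: (i == j).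
split; apply/matrixP => i j; apply: pseriesP => k; rewrite c1.
  rewrite mulmxBl mul1mx !mxE [pcoef _ _]/= pcoef_sum.
  under eq_bigr do rewrite !mxE -mulrA pcoef_pcstM pcoef_pXM.
  case: k => [|k]; first by rewrite big1 ?subr0 ?mxE // => l _; rewrite mulr0.
  by rewrite /= !mxE subrr.
rewrite mulmxBr mulmx1 !mxE [pcoef _ _]/= pcoef_sum.
under eq_bigr do rewrite !mxE mulrA -pXC pcoef_pXM.
case: k => [|k]; first by rewrite big1 ?subr0 ?mxE // => l _; rewrite mulr0.
rewrite -iterC !mxE -sumrB big1 // => l _.
rewrite pcoefM big_ord_recr big1 /=; last first.
  by move=> m _; rewrite mulrnAr (_ : _ == _ = false) ?mulr0n // subn_eq0 leqNgt ltn_ord.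
by rewrite add0r subnn mulr1n subrr.
Qed.

Lemma one_sub_x_inv n (alpha : 'M[A]_n) : invertible_mx (one_sub_x alpha).
Proof. by exists (geom_mx alpha); apply: one_sub_x_geom. Qed.

Definition char_class n (alpha : 'M[A]_n) : K1 (pseries A) :=
  K1_class (one_sub_x_inv alpha).

Definition char_endo (e : endo A) : K1 (pseries A) := char_class (tagged e).

Lemma one_sub_xE n (alpha : 'M[A]_n) :
  one_sub_x alpha = 1%:M - pX *: map_mx (@pcst A) alpha.
Proof. by congr (_ - _); apply/matrixP => i j; rewrite !mxE pXC. Qed.

Lemma scale_pXr n m p (M : 'M[pseries A]_(n, m)) (N : 'M[pseries A]_(m, p)) :
  M *m (pX *: N) = pX *: (M *m N).
Proof.
apply/matrixP => i j; rewrite !mxE mulr_sumr; apply: eq_bigr => k _.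
by rewrite !mxE !mulrA pXC.
Qed.

Lemma one_sub_x_conj n m (P : 'M[A]_(n, m)) (Q : 'M[A]_(m, n)) (alpha : 'M[A]_n) :
  Q *m P = 1%:M ->
  map_mx (@pcst A) Q *m one_sub_x alpha *m map_mx (@pcst A) P =
  one_sub_x (Q *m alpha *m P).
Proof.
move=> QP; rewrite !one_sub_xE mulmxBr mulmx1 mulmxBl -map_mxM QP map_mx1.
by rewrite scale_pXr -scalemxAl -!map_mxM.
Qed.

Lemma char_class_iso n m (P : 'M[A]_(n, m)) (Q : 'M[A]_(m, n)) (alpha : 'M[A]_n) :
  P *m Q = 1%:M -> Q *m P = 1%:M -> char_class (Q *m alpha *m P) = char_class alpha.
Proof.
move=> PQ QP; have e := one_sub_x_conj alpha QP.
have i : invertible_mx (map_mx (@pcst A) Q *m one_sub_x alpha *m map_mx (@pcst A) P).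
  by rewrite e; apply: one_sub_x_inv.
rewrite /char_class -(K1_class_iso (one_sub_x_inv alpha) i); last 2 first.
- by rewrite -map_mxM PQ map_mx1.
- by rewrite -map_mxM QP map_mx1.
by apply: K1_class_inf; rewrite e.
Qed.

Lemma char_class_lblock n m (alpha : 'M[A]_n) (beta : 'M[A]_m) (C : 'M[A]_(m, n)) :
  char_class (block_mx alpha 0 C beta) = char_class alpha + char_class beta.
Proof.
have e : one_sub_x (block_mx alpha 0 C beta) =
    block_mx (one_sub_x alpha) 0 (- (pX *: map_mx (@pcst A) C)) (one_sub_x beta).
  rewrite !one_sub_xE map_block_mx map_mx0 scale_block_mx scaler0 scalar_mx_block.
  by rewrite opp_block_mx add_block_mx oppr0 addr0 add0r.
have i : invertible_mx (block_mx (one_sub_x alpha) 0 (- (pX *: map_mx (@pcst A) C))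
    (one_sub_x beta)) by rewrite -e; apply: one_sub_x_inv.
rewrite /char_class -(K1_class_lblock (one_sub_x_inv alpha) (one_sub_x_inv beta) i).
by apply: K1_class_inf; rewrite e.
Qed.

Lemma rmul_mx_inj n m p (theta : 'M[A]_(n, m)) (M N : 'M[A]_(p, n)) :
  injective (rmul_mx theta) -> M *m theta = N *m theta -> M = N.
Proof.
move=> inj e; apply/row_matrixP => i; apply: inj.
by rewrite /rmul_mx -!row_mul e.
Qed.

Lemma rmul_mx_factor n m p (theta : 'M[A]_(n, m)) (M : 'M[A]_(p, m)) :
  (forall i, exists u, rmul_mx theta u = row i M) -> exists N, N *m theta = M.
Proof.
move=> h; pose f i := sval (cid (h i)); exists (\matrix_i f i).
by apply/row_matrixP => i; rewrite row_mul rowK -[RHS](svalP (cid (h i))).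
Qed.

Lemma char_endo_rel u : End0_rel u -> free_lift char_endo u = 0.
Proof.
case=> [n n' alpha alpha' theta [[g thK gK] e]
       |n n' n'' alpha alpha' alpha'' theta theta' [inj ex surj] e e'|n].
- rewrite raddfB /= !free_liftU; apply/eqP; rewrite subr_eq0; apply/eqP.
  have [rho rt] : exists rho, rho *m theta = 1%:M.
    by apply: rmul_mx_factor => i; exists (g (row i 1%:M)); apply: gK.
  have tr : theta *m rho = 1%:M.
    apply: (rmul_mx_inj (can_inj thK)).
    by rewrite -mulmxA rt mulmx1 mul1mx.
  rewrite /char_endo /= -[RHS](char_class_iso alpha' rt tr).
  by rewrite -e -mulmxA tr mulmx1.
- rewrite raddfB raddfD /= !free_liftU /char_endo /=.
  have [sigma st] : exists sigma, sigma *m theta' = 1%:M.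
    by apply: rmul_mx_factor => i; apply: surj.
  have tt : theta *m theta' = 0.
    apply/row_matrixP => i; rewrite row_mul row0.
    by apply/(ex (row i theta)); exists (row i 1%:M); rewrite /rmul_mx -row_mul mul1mx.
  have [rho rt] : exists rho, rho *m theta = 1%:M - theta' *m sigma.
    apply: rmul_mx_factor => i; apply/ex.
    by rewrite /rmul_mx -row_mul mulmxBl mul1mx -mulmxA st mulmx1 subrr row0.
  have tr : theta *m rho = 1%:M.
    apply: (rmul_mx_inj inj).
    by rewrite -mulmxA rt mulmxBr mulmx1 mulmxA tt mul0mx subr0 mul1mx.
  have sr : sigma *m rho = 0.
    apply: (rmul_mx_inj inj).
    by rewrite -mulmxA rt mulmxBr mulmx1 mulmxA st mul1mx subrr mul0mx.
  pose P := row_mx rho theta'; pose Q := col_mx theta sigma.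
  have PQ : P *m Q = 1%:M by rewrite mul_row_col rt subrK.
  have QP : Q *m P = 1%:M.
    by rewrite mul_col_row tr tt sr st -scalar_mx_block.
  rewrite -(char_class_iso alpha' PQ QP).
  have -> : Q *m alpha' *m P = block_mx alpha 0 (sigma *m alpha' *m rho) alpha''.
    rewrite mul_col_mx mul_col_row -e -!(mulmxA alpha) tr mulmx1 tt mulmx0.
    by rewrite -(mulmxA sigma alpha' theta') e' mulmxA st mul1mx.
  by rewrite char_class_lblock subrr.
- rewrite free_liftU /char_endo /= -(K1_class_id (invertible_mx1 (pseries A) n)).
  by apply: K1_class_inf; rewrite one_sub_xE map_mx0 scaler0 subr0.
Qed.

(* The homomorphism induced on the quotient by [alpha] |-> [1 - alpha x]; it is
   well defined by [char_endo_rel], and its values are given by [chE]. *)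
Definition ch : End0 A -> K1 (pseries A) :=
  @zq_lift _ (@End0_rel A) _ (free_lift char_endo).

HB.instance Definition _ := GRing.isZmodMorphism.Build (End0 A) (K1 (pseries A)) ch
  (zq_lift_is_zmod_morphism char_endo_rel).

Lemma chE n (alpha : 'M[A]_n) :
  ch (End0_class alpha) = K1_class (one_sub_x_inv alpha).
Proof. by rewrite /ch (zq_lift_pi char_endo_rel) /= free_liftU. Qed.

End Characteristic.

(* Main.v *)
Require Import Defs.
From mathcomp Require Import all_boot all_order all_algebra boolp.
From mathcomp.multinomials Require Import monalg.

(** The two endomorphisms that are compared are s on S and the matrix
      alpha = [[0, f], [g, s]]   on S^2.
    Over S[[x]] the Schur complement of the block 1 - s x in 1 - alpha x is
      1 - x^2 f (1 - s x)^-1 g = 1 - sum_i x^(i+2) f s^i g = 1,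
    so that 1 - alpha x and 1 - s x have the same class in K_1
    ([char_class_schur]).

    The classes of alpha and s in the endomorphism class group differ because a
    finite number of relations f s^i g = 0 never suffices to carry out this
    computation, and the class group sees that. The witness is an additive map
    tau from the free ring Z<f,s,g> to Z['X]: a word w goes to 'X^(length of w)
    if some cyclic rotation of w is of the form f s^j g, and to 0 otherwise.
    It is a trace, tau (u v) = tau (v u), because the rule is invariant under
    rotation. On the defining ideal I of S it does not vanish, but it is bounded
    there: tau (c f s^i g) only depends on the constant coefficient of c, since
    no rotation of w f s^i g is of the form f s^j g unless w is empty.
    Consequently, for every u in I, the degrees of the polynomials tau (c u) are
    bounded independently of c ([tau_ideal_bounded]).

    For a square matrix A over S choose a lift A' to the free ring and consider
    the sequence of polynomials tau (tr (A'^k)), k >= 1. Another lift changes it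
    by a sequence of bounded degree: in A'^k - A''^k = sum A'^i (A' - A'') A''^j
    the trace property moves the factor with entries in I to the end
    ([power_trace_bounded]). Modulo sequences of bounded degree the sequence is
    therefore an invariant of A. It is additive on extensions, since conjugate
    matrices have conjugate lifts up to I and block triangular matrices have
    block triangular lifts, and it vanishes on zero matrices; so it is defined on
    the endomorphism class group ([End0_class_trace]). It is 0 for s, whereas for
    alpha its k-th term contains 'X^k: the word f s^(k-2) g occurs in
    tr (alpha'^k), and no cancellation is possible because all words occur with
    nonnegative coefficients ([companion_lift_trace_gt0]). *)

Set Implicit Arguments.
Unset Strict Implicit.
Unset Printing Implicit Defensive.

Import Order.TTheory GRing.Theory Num.Theory.
Local Open Scope ring_scope.

(** * Sequences of polynomials of bounded degree *)

(** The additive group of all sequences of integer polynomials is represented by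
    [pseries {poly int}]. *)
Definition bounded_degree (p : pseries {poly int}) : Prop :=
  exists N, forall k, (size (pcoef p k) <= N)%N.

Lemma bounded_degree0 : bounded_degree 0.
Proof. by exists 0%N => k; rewrite size_poly0. Qed.

Lemma bounded_degreeB p q :
  bounded_degree p -> bounded_degree q -> bounded_degree (p - q).
Proof.
move=> [N hN] [M hM]; exists (maxn N M) => k.
by rewrite (leq_trans (size_polyD _ _)) // size_polyN geq_max !leq_max hN hM orbT.
Qed.

Lemma bounded_degreeD p q :
  bounded_degree p -> bounded_degree q -> bounded_degree (p + q).
Proof.
move=> hp hq; rewrite -[q]opprK -[- q]sub0r.
by do 2!apply: bounded_degreeB => //; apply: bounded_degree0.
Qed.

(** * Splitting short exact sequences of free modules *)

(** The equations say that [row_mx rho theta'] and [col_mx theta sigma] are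
    mutually inverse, up to the vanishing of [sigma *m rho]. *)
Lemma short_exact_split (A : pzRingType) n n' n''
    (theta : 'M[A]_(n, n')) (theta' : 'M[A]_(n', n'')) :
  short_exact theta theta' -> exists rho sigma,
  [/\ rho *m theta + theta' *m sigma = 1%:M, theta *m rho = 1%:M,
      sigma *m theta' = 1%:M & theta *m theta' = 0].
Proof.
move=> [inj ex surj].
have [sigma st] : exists sigma, sigma *m theta' = 1%:M.
  by apply: rmul_mx_factor => i; apply: surj.
have tt : theta *m theta' = 0.
  apply/row_matrixP => i; rewrite row_mul row0.
  by apply/(ex (row i theta)); exists (row i 1%:M); rewrite /rmul_mx -row_mul mul1mx.
have [rho rt] : exists rho, rho *m theta = 1%:M - theta' *m sigma.
  apply: rmul_mx_factor => i; apply/ex.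
  by rewrite /rmul_mx -row_mul mulmxBl mul1mx -mulmxA st mulmx1 subrr row0.
exists rho, sigma; split=> //; first by rewrite rt subrK.
apply: (rmul_mx_inj inj).
by rewrite -mulmxA rt mulmxBr mulmx1 mulmxA tt mul0mx subr0 mul1mx.
Qed.

(** * The trace invariant of endomorphisms over a quotient ring *)

Section TraceInvariant.
Variables (R : pzRingType) (X : R -> Prop) (tau : {additive R -> {poly int}}).
Hypothesis tauC : forall u v, tau (u * v) = tau (v * u).
Hypothesis tauX : forall x, X x -> exists N, forall c, (size (tau (c * x)%R) <= N)%N.

(** The bound survives multiplication of [x] on the right because the trace
    property turns it into multiplication on the left. *)
Lemma tau_ideal_bounded x :
  ideal_gen X x -> exists N, forall c, (size (tau (c * x)%R) <= N)%N.
Proof.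
elim=> [y /tauX //||y z _ [N hN] _ [M hM]|a y _ [N hN]|a y _ [N hN]].
- by exists 0%N => c; rewrite mulr0 raddf0 size_poly0.
- exists (maxn N M) => c; rewrite mulrBr raddfB.
  by rewrite (leq_trans (size_polyD _ _)) // size_polyN geq_max !leq_max hN hM orbT.
- by exists N => c; rewrite mulrA.
- by exists N => c; rewrite mulrA tauC mulrA.
Qed.

Definition tau_tr n (A : 'M[R]_n) : {poly int} := tau (\tr A).

Lemma tau_trC n m (A : 'M[R]_(n, m)) (B : 'M[R]_(m, n)) :
  tau_tr (A *m B) = tau_tr (B *m A).
Proof.
rewrite /tau_tr /mxtrace !raddf_sum /=.
under eq_bigr do rewrite mxE raddf_sum /=.
under [RHS]eq_bigr do rewrite mxE raddf_sum /=.
by rewrite exchange_big; do 2!apply: eq_bigr => ? _; apply: tauC.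
Qed.

(** The exponents start at 1: for exponent 0 the identity matrices of sizes [n]
    and [m] would break [power_traceC]. *)
Definition power_trace n (A : 'M[R]_n) : pseries {poly int} :=
  PSeries (fun k => tau_tr (A ^+ k.+1)).

Lemma power_traceC n m (A : 'M[R]_(n, m)) (B : 'M[R]_(m, n)) :
  power_trace (A *m B) = power_trace (B *m A).
Proof.
apply: pseriesP => k /=.
suff -> : (A *m B) ^+ k.+1 = A *m ((B *m A) ^+ k *m B).
  by rewrite tau_trC exprSr -mulmxA.
elim: k => [|k IH]; first by rewrite expr1 expr0 mul1mx.
by rewrite exprS IH [in RHS]exprS -!mulmxE !mulmxA.
Qed.

(** The matrix form of [tau_ideal_bounded]: only finitely many entries of [J]
    contribute, whatever [C] is. *)
Lemma tau_tr_ideal_bounded n (J : 'M[R]_n) : (forall i j, ideal_gen X (J i j)) ->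
  exists N, forall C : 'M[R]_n, (size (tau_tr (C *m J)%R) <= N)%N.
Proof.
move=> hJ; pose N i j := sval (cid (tau_ideal_bounded (hJ i j))).
have hN i j c : (size (tau (c * J i j)%R) <= N i j)%N.
  exact: (svalP (cid (tau_ideal_bounded (hJ i j)))).
exists (\max_i \max_j N j i) => C.
rewrite /tau_tr /mxtrace raddf_sum (leq_trans (size_sum _ _ _)) //.
apply/bigmax_leqP => i _; apply: (leq_trans _ (leq_bigmax i)).
rewrite mxE raddf_sum (leq_trans (size_sum _ _ _)) //.
apply/bigmax_leqP => j _; exact: (leq_trans (hN j i _) (leq_bigmax j)).
Qed.

(** Telescoping writes [A ^+ k - B ^+ k] as a sum of terms
    [A ^+ i *m (A - B) *m B ^+ j], in which the trace property moves [A - B] to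
    the end. The number of terms grows with [k], but their degrees do not. *)
Lemma power_trace_bounded n (A B : 'M[R]_n) :
  (forall i j, ideal_gen X ((A - B) i j)) ->
  bounded_degree (power_trace A - power_trace B).
Proof.
move=> /tau_tr_ideal_bounded[N hN]; exists N => k.
(* The extra factor C makes the induction go through with a constant bound. *)
have h m (C : 'M[R]_n) : (size (tau_tr (C *m (A ^+ m - B ^+ m))%R) <= N)%N.
  elim: m C => [|m IH] C.
    by rewrite subrr mulmx0 /tau_tr mxtrace0 raddf0 size_poly0.
  have -> : C *m (A ^+ m.+1 - B ^+ m.+1) =
      C *m A *m (A ^+ m - B ^+ m) + C *m ((A - B) *m B ^+ m).
    rewrite !exprS -!mulmxE mulmxBl -mulmxA -mulmxDr; congr (_ *m _).
    by rewrite mulmxBr addrA subrK.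
  rewrite /tau_tr raddfD raddfD (leq_trans (size_polyD _ _)) // geq_max.
  by rewrite IH -/(tau_tr _) mulmxA tau_trC mulmxA hN.
have -> : pcoef (power_trace A - power_trace B) k =
    tau_tr (1%:M *m (A ^+ k.+1 - B ^+ k.+1)) by rewrite mul1mx /tau_tr !raddfB.
exact: h.
Qed.

Local Notation S := (ring_quot X).

Definition mx_lift n m (A : 'M[S]_(n, m)) : 'M[R]_(n, m) := map_mx repr A.

Lemma mx_liftK n m (A : 'M[S]_(n, m)) : map_mx (rq_pi X) (mx_lift A) = A.
Proof. by apply/matrixP => i j; rewrite !mxE /rq_pi reprK. Qed.

Definition quot_trace n (A : 'M[S]_n) : pseries {poly int} :=
  power_trace (mx_lift A).

Lemma power_trace_lift n (A : 'M[R]_n) (B : 'M[S]_n) :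
  map_mx (rq_pi X) A = B -> bounded_degree (quot_trace B - power_trace A).
Proof.
move=> <-; apply: power_trace_bounded => i j; rewrite !mxE.
by apply/rq_piP; rewrite /rq_pi reprK.
Qed.

(** Cyclicity replaces [Q *m A *m P] by [A *m P *m Q] at the level of lifts, and
    the latter is one more lift of [A]. The equation [P *m Q = 1%:M] suffices, so
    that [n] and [m] may differ. *)
Lemma quot_trace_conj n m (P : 'M[S]_(n, m)) (Q : 'M[S]_(m, n)) (A : 'M[S]_n) :
  P *m Q = 1%:M -> bounded_degree (quot_trace (Q *m A *m P) - quot_trace A).
Proof.
move=> PQ; pose A' := mx_lift Q *m (mx_lift A *m mx_lift P).
have -> : quot_trace (Q *m A *m P) - quot_trace A =
    (quot_trace (Q *m A *m P) - power_trace A') - (quot_trace A - power_trace A').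
  by rewrite opprB addrA subrK.
apply: bounded_degreeB; last rewrite power_traceC; apply: power_trace_lift.
  by rewrite !map_mxM !mx_liftK mulmxA.
by rewrite !map_mxM !mx_liftK -mulmxA PQ mulmx1.
Qed.

Lemma power_trace_lblock n m (A : 'M[R]_n) (B : 'M[R]_m) (C : 'M[R]_(m, n)) :
  power_trace (block_mx A 0 C B) = power_trace A + power_trace B.
Proof.
apply: pseriesP => k /=; rewrite /tau_tr -raddfD.
suff [D ->] : exists D, block_mx A 0 C B ^+ k.+1 = block_mx (A ^+ k.+1) 0 D (B ^+ k.+1).
  by rewrite mxtrace_block.
elim: k => [|k [D IH]]; first by exists C; rewrite !expr1.
exists (C *m A ^+ k.+1 + B *m D).
rewrite exprS IH -mulmxE mulmx_block !mul0mx !mulmx0 !addr0 add0r.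
by rewrite !mulmxE -!exprS.
Qed.

Lemma quot_trace_lblock n m (A : 'M[S]_n) (B : 'M[S]_m) (C : 'M[S]_(m, n)) :
  bounded_degree (quot_trace (block_mx A 0 C B) - (quot_trace A + quot_trace B)).
Proof.
rewrite /quot_trace -(power_trace_lblock _ _ (mx_lift C)).
apply: power_trace_lift.
by rewrite map_block_mx !mx_liftK map_mx0.
Qed.

Lemma quot_trace0 n : bounded_degree (quot_trace (0 : 'M[S]_n)).
Proof.
have -> : quot_trace (0 : 'M[S]_n) = quot_trace (0 : 'M[S]_n) - power_trace (0 : 'M[R]_n).
  rewrite (_ : power_trace 0 = 0) ?subr0 //; apply: pseriesP => k /=.
  by rewrite exprS -mulmxE mul0mx /tau_tr mxtrace0 raddf0.
by apply: power_trace_lift; rewrite map_mx0.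
Qed.

Definition endo_trace (e : endo S) : pseries {poly int} := quot_trace (tagged e).

(** An isomorphism is a conjugation, and a splitting conjugates the middle term of
    an extension into a block triangular matrix. *)
Lemma End0_rel_trace u : End0_rel u -> bounded_degree (free_lift endo_trace u).
Proof.
case=> [n n' alpha alpha' theta [[g thK gK] e]
       |n n' n'' alpha alpha' alpha'' theta theta' ex e e'|n].
- rewrite raddfB /= !free_liftU /endo_trace /= -opprB -sub0r.
  apply: bounded_degreeB; first exact: bounded_degree0.
  have [rho rt] : exists rho, rho *m theta = 1%:M.
    by apply: rmul_mx_factor => i; exists (g (row i 1%:M)); apply: gK.
  have tr : theta *m rho = 1%:M.
    by apply: (rmul_mx_inj (can_inj thK)); rewrite -mulmxA rt mulmx1 mul1mx.
  have -> : alpha' = rho *m alpha *m theta by rewrite -mulmxA e mulmxA rt mul1mx.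
  exact: quot_trace_conj.
- rewrite raddfB raddfD /= !free_liftU /endo_trace /=.
  have [rho [sigma [id' tr st tt]]] := short_exact_split ex.
  pose P := row_mx rho theta'; pose Q := col_mx theta sigma.
  have PQ : P *m Q = 1%:M by rewrite mul_row_col.
  have E : Q *m alpha' *m P = block_mx alpha 0 (sigma *m alpha' *m rho) alpha''.
    rewrite mul_col_mx mul_col_row -e -!(mulmxA alpha) tr mulmx1 tt mulmx0.
    by rewrite -(mulmxA sigma alpha' theta') e' mulmxA st mul1mx.
  have h := quot_trace_conj alpha' PQ; rewrite E in h.
  have := bounded_degreeB h (quot_trace_lblock alpha alpha'' (sigma *m alpha' *m rho)).
  by rewrite opprB addrC addrA subrK.
- by rewrite free_liftU; apply: quot_trace0.
Qed.

Lemma zmod_gen_trace u :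
  zmod_gen (@End0_rel S) u -> bounded_degree (free_lift endo_trace u).
Proof.
elim=> [x /End0_rel_trace //||x y _ hx _ hy].
  by rewrite raddf0; apply: bounded_degree0.
by rewrite raddfB; apply: bounded_degreeB.
Qed.

(** The tool that separates classes: modulo sequences of bounded degree,
    [quot_trace] factors through the endomorphism class group. *)
Lemma End0_class_trace n m (A : 'M[S]_n) (B : 'M[S]_m) :
  End0_class A = End0_class B -> bounded_degree (quot_trace A - quot_trace B).
Proof.
by move/zq_piP/zmod_gen_trace; rewrite raddfB /= !free_liftU.
Qed.
End TraceInvariant.

(** * Additive maps on monoid rings *)

Lemma malg_word_ind (K : choiceType) (P : {malg int[K]} -> Prop) :
  P 0 -> (forall u v, P u -> P v -> P (u - v)) -> (forall k, P << k >>) ->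
  forall u, P u.
Proof.
move=> P0 PB PU u; have PN v : P v -> P (- v) by rewrite -sub0r; apply: PB.
have PD v w : P v -> P w -> P (v + w) by move=> hv /PN; rewrite -{2}[w]opprK; apply: PB.
rewrite [u]monalgE; elim/big_ind: _ => // k _.
have Pn n : P (<< n%:R *g k >>).
  by elim: n => [|n IH]; rewrite ?monalgU0 // -natr1 monalgUD; apply: PD.
case: (u@_k)%R => n; first by rewrite -[Posz n]natz; apply: Pn.
by rewrite NegzE monalgUN -natz; apply/PN/Pn.
Qed.

Lemma malg_trace (K : monomType) (W : zmodType) (h : {additive {malg int[K]} -> W}) :
  (forall k l : K, h (<< k >> * << l >>) = h (<< l >> * << k >>)) ->
  forall u v, h (u * v) = h (v * u).
Proof.
move=> hC u v; elim/malg_word_ind: u => [|u1 u2 h1 h2|u].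
- by rewrite mul0r mulr0.
- by rewrite mulrBl mulrBr 2!raddfB h1 h2.
elim/malg_word_ind: v => [|v1 v2 h1 h2|v]; first by rewrite mul0r mulr0.
  by rewrite mulrBl mulrBr 2!raddfB h1 h2.
exact: hC.
Qed.

Lemma malg_mull_bounded (K : monomType)
    (h : {additive {malg int[K]} -> {poly int}}) x N :
  (forall k : K, (size (h (<< k >> * x)%R) <= N)%N) ->
  forall u, (size (h (u * x)%R) <= N)%N.
Proof.
move=> hN u; elim/malg_word_ind: u => [|u1 u2 h1 h2|u]; last exact: hN.
  by rewrite mul0r raddf0 size_poly0.
by rewrite mulrBl raddfB (leq_trans (size_polyD _ _)) // size_polyN geq_max h1 h2.
Qed.

(** * The trace on the free ring *)

Local Notation word := {fmonom 'I_3}.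

Definition index_f : 'I_3 := @Ordinal 3 0 isT.
Definition index_s : 'I_3 := @Ordinal 3 1 isT.
Definition index_g : 'I_3 := @Ordinal 3 2 isT.

Definition fsg_word j : seq 'I_3 := index_f :: rcons (nseq j index_s) index_g.

Definition cyclic_fsg (w : seq 'I_3) : Prop := exists i j, rot i w = fsg_word j.

Lemma cyclic_fsg_catC u v : cyclic_fsg (u ++ v) <-> cyclic_fsg (v ++ u).
Proof.
have h a b : cyclic_fsg (a ++ b) -> cyclic_fsg (b ++ a).
  move=> [i [j e]]; exists (rot_add (b ++ a) (size b) i), j.
  by rewrite -rot_rot_add rot_size_cat.
by split; apply: h.
Qed.

(** A word f s^j g has a single f. A rotation of the given word that starts with f
    but is not trivial has two of them, since it contains the initial f of the
    given word further on. Hence the given word is f s^j g itself, and its first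
    g is its last letter. *)
Lemma cyclic_fsg_relator_cat m v :
  cyclic_fsg (index_f :: nseq m index_s ++ index_g :: v) -> v = [::].
Proof.
move=> [i [j]]; set w := index_f :: _ => e.
have key : w = fsg_word j -> v = [::].
  rewrite /w /fsg_word -cats1 -(cat1s index_g v) => -[e'].
  have /(congr1 (index index_g)) := e'.
  rewrite !index_cat !mem_nseq !andbF /= !size_nseq !addn0 => mj.
  move/(congr1 size): e'; rewrite mj !size_cat => /addnI [].
  exact: size0nil.
(* Rotations by 0 and by at least the length are the identity. *)
have [i0|i_gt0] := posnP i; first by apply: key; rewrite -e i0 rot0.
have [si|si] := leqP (size w) i; first by apply: key; rewrite -e rot_oversize.
have [d dE] : exists d, drop i w = index_f :: d.
  move: e; rewrite /rot; case E: (drop i w) => [|x d].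
    by move/(congr1 size): E; rewrite size_drop => /eqP; rewrite subn_eq0 leqNgt si.
  by move=> [-> _]; exists d.
have : count_mem index_f (fsg_word j) = 1%N by rewrite /= -cats1 count_cat count_nseq.
by rewrite -e /rot dE count_cat /w -(prednK i_gt0) /= addnS.
Qed.

Definition cyclic_weight (w : word) : {poly int} :=
  if `[< cyclic_fsg w >] then 'X^(size w) else 0.

(** The map is locked because unification against additive maps would otherwise
    unfold it. *)
Definition fsg_trace : {additive free_ring3 -> {poly int}} :=
  locked (free_lift cyclic_weight : {additive free_ring3 -> {poly int}}).

Lemma wordM (u v : word) : << u >> * << v >> = << mmul u v >> :> free_ring3.
Proof. by rewrite malgM_def fgmulUU mulr1. Qed.

Lemma fsg_trace_word w : fsg_trace << w >> = cyclic_weight w.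
Proof. by rewrite /fsg_trace -lock; apply: free_liftU. Qed.

Lemma fsg_traceC u v : fsg_trace (u * v) = fsg_trace (v * u).
Proof.
move: u v; apply: malg_trace => u v; rewrite !wordM !fsg_trace_word.
rewrite /cyclic_weight /mmul /= !fmmulE /=.
rewrite !size_cat addnC; congr (if _ then _ else _).
by apply/asbool_equiv_eq/cyclic_fsg_catC.
Qed.

Lemma free_s_expE m : free_s ^+ m = << FMonom (nseq m index_s) >>.
Proof.
elim: m => [|m IH]; first by rewrite expr0 -fmoneE.
by rewrite exprS IH /free_s /letter wordM fmuE /mmul /= fmmulE.
Qed.

Lemma relatorE m :
  free_f * free_s ^+ m * free_g =
  << FMonom (index_f :: nseq m index_s ++ [:: index_g]) >>.
Proof.
by rewrite free_s_expE /free_f /free_g /letter !wordM !fmuE /mmul /= !fmmulE.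
Qed.

(** The empty word is the only word [u] for which [u * f * s ^+ m * g] has
    nonzero trace, namely 'X^(m + 2). *)
Lemma fsg_trace_relator_bounded x : S_relator x ->
  exists N, forall c, (size (fsg_trace (c * x)%R) <= N)%N.
Proof.
move=> [m ->]; exists m.+3 => c; rewrite relatorE.
apply: malg_mull_bounded c => u.
rewrite wordM fsg_trace_word /cyclic_weight; case: asboolP => [|_];
  last by rewrite size_poly0.
rewrite /mmul /= fmmulE /= => /cyclic_fsg_catC; rewrite -[_ ++ _]/(index_f :: (_ ++ _)).
rewrite -catA => /cyclic_fsg_relator_cat ->.
by rewrite /= size_polyXn size_cat size_nseq addn1.
Qed.

Lemma fsg_trace_s k : fsg_trace (free_s ^+ k) = 0.
Proof.
rewrite free_s_expE fsg_trace_word /cyclic_weight; case: asboolP => // -[i [j e]].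
have : index_f \in rot i (nseq k index_s) by rewrite e mem_head.
by rewrite mem_rot mem_nseq andbF.
Qed.

Lemma fsg_trace_ge0 u k :
  u \is a monalgOver Num.nneg -> 0 <= (fsg_trace u)`_k.
Proof.
move=> /monalgOverP u_ge0; rewrite [u]monalgE (raddf_sum fsg_trace) coef_sum.
rewrite sumr_ge0 // => w _.
have -> : << u@_w *g w >> = << w >> *~ u@_w :> free_ring3.
  by rewrite -raddfMz /= intz.
rewrite raddfMz /= fsg_trace_word coefMrz.
rewrite mulrz_ge0 //; last exact: u_ge0.
rewrite /cyclic_weight; case: asboolP => _; last by rewrite coef0.
by rewrite coefXn ler0n.
Qed.

(** * Equality of characteristic classes *)

Lemma scalar_mx_exp (R : pzRingType) n (a : R) k :
  (a%:M : 'M_n) ^+ k = (a ^+ k)%:M.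
Proof. by elim: k => // k IH; rewrite !exprS IH -mulmxE -scalar_mxM. Qed.

(** Interchanging the two blocks reduces this to the lower triangular case. *)
Lemma K1_class_upper_unip (R : pzRingType) n m (Y : 'M[R]_(n, m))
    (iY : invertible_mx (block_mx (1%:M : 'M_n) Y 0 (1%:M : 'M_m))) :
  K1_class iY = 0.
Proof.
pose P k l : 'M[R]_(k + l, l + k) := block_mx 0 1%:M 1%:M 0.
have PP k l : P k l *m P l k = 1%:M.
  by rewrite mulmx_block !(mulmx0, mul0mx, addr0, add0r, mul1mx) -scalar_mx_block.
have e : P m n *m block_mx 1%:M Y 0 1%:M *m P n m = block_mx 1%:M 0 Y 1%:M.
  by rewrite !mulmx_block !(mulmx0, mul0mx, addr0, add0r, mul1mx, mulmx1).
have iL : invertible_mx (P m n *m block_mx 1%:M Y 0 1%:M *m P n m).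
  rewrite e; exists (block_mx 1%:M 0 (- Y) 1%:M).
  by rewrite !mulmx_block !(mulmx0, mul0mx, addr0, add0r, mul1mx, mulmx1)
     addrN addNr -scalar_mx_block.
rewrite -(K1_class_iso iY iL (PP _ _) (PP _ _)); move: iL; rewrite e => iL.
exact: K1_class_unip.
Qed.

Section SchurComplement.
Variables (A : pzRingType) (n m : nat).
Variables (F : 'M[A]_(n, m)) (S : 'M[A]_m) (G : 'M[A]_(m, n)).
Hypothesis FSG : forall k, F *m S ^+ k *m G = 0.

Local Notation cst := (map_mx (@pcst A)).

(** This is the power series [sum_k F S^k G x^k]. *)
Lemma geom_sandwich0 : cst F *m geom_mx S *m cst G = 0.
Proof.
have iterE k : iter k (mulmx S) 1%:M = S ^+ k.
  by elim: k => //= k ->; rewrite exprS.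
apply/matrixP => i j; apply: pseriesP => k; rewrite !mxE pcoef_sum.
have -> : pcoef 0 k = (F *m S ^+ k *m G) i j by rewrite FSG mxE.
rewrite mxE; apply: eq_bigr => l _; rewrite !mxE pcoefM big_ord_recr /=.
rewrite big1 ?add0r => [|p _]; last first.
  by rewrite (_ : _ == _ = false) ?mulr0n ?mulr0 // subn_eq0 leqNgt ltn_ord.
rewrite subnn mulr1n pcoef_sum; congr (_ * _); apply: eq_bigr => q _.
by rewrite !mxE pcoef_pcstM /= iterE.
Qed.

(** Block elimination of [1 - S x]: the Schur complement is
    [1 - x^2 F (1 - S x)^-1 G = 1]. *)
Lemma char_class_schur : char_class (block_mx 0 F G S) = char_class S.
Proof.
pose U : 'M[pseries A]_(n + m) := block_mx 1%:M (- (pX *: (cst F *m geom_mx S))) 0 1%:M.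
pose L : 'M[pseries A]_(n + m) := block_mx 1%:M 0 (- (pX *: cst G)) (one_sub_x S).
have iU : invertible_mx U.
  exists (block_mx 1%:M (pX *: (cst F *m geom_mx S)) 0 1%:M).
  by rewrite !mulmx_block !(mulmx0, mul0mx, addr0, add0r, mul1mx, mulmx1)
     addrN addNr -scalar_mx_block.
have [SU US] := one_sub_x_geom S.
have iL : invertible_mx L.
  exists (block_mx 1%:M 0 (geom_mx S *m (pX *: cst G)) (geom_mx S)).
  rewrite !mulmx_block !(mulmx0, mul0mx, addr0, add0r, mul1mx, mulmx1).
  by rewrite mulmxA SU US mul1mx mulmxN addNr addrN -scalar_mx_block.
have UL : one_sub_x (block_mx 0 F G S) = U *m L.
  rewrite mulmx_block !(mulmx0, mul0mx, addr0, add0r, mul1mx, mulmx1).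
  rewrite mulNmx mulmxN opprK scale_pXr -scalemxAl geom_sandwich0 !scaler0 addr0.
  rewrite mulNmx -scalemxAl -mulmxA US mulmx1 !one_sub_xE map_block_mx map_mx0.
  by rewrite scale_block_mx scaler0 scalar_mx_block opp_block_mx add_block_mx oppr0
             addr0 !add0r.
have iUL := invertible_mxM iU iL.
have -> : char_class (block_mx 0 F G S) = K1_class iUL.
  by apply: K1_class_inf; rewrite UL.
have i1 := invertible_mx1 (pseries A) n.
rewrite (K1_classM iU iL) K1_class_upper_unip add0r.
by rewrite (K1_class_lblock i1 (one_sub_x_inv S)) K1_class_id add0r.
Qed.
End SchurComplement.

(** * Traces of powers *)

Section CompanionTrace.
Variables (R : pzRingType) (P : R -> Prop).
Hypotheses (P0 : P 0) (PD : forall u v, P u -> P v -> P (u + v)).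
Hypothesis PM : forall u v, P u -> P v -> P (u * v).
Variables f s g : R.
Hypotheses (Pf : P f) (Ps : P s) (Pg : P g).

Local Notation C := (block_mx 0 f%:M g%:M s%:M : 'M_(1 + 1)).

Lemma mul_companion_block a b c d :
  C *m block_mx a%:M b%:M c%:M d%:M =
  block_mx (f * c)%:M (f * d)%:M (g * a + s * c)%:M (g * b + s * d)%:M.
Proof. by rewrite mulmx_block !mul0mx !add0r -!scalar_mxM -!raddfD. Qed.

Lemma companion_powers m : exists a b c d : R,
  [/\ C ^+ m.+1 = block_mx a%:M b%:M (s ^+ m * g + c)%:M d%:M, P a, P b, P c & P d].
Proof.
elim: m => [|m [a [b [c [d [IH Pa Pb Pc Pd]]]]]].
  by exists 0, f, 0, s; split; rewrite // expr1 mul1r addr0 raddf0.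
have Psm : P (s ^+ m * g).
  elim: (m) => [|k IHk]; first by rewrite mul1r.
  by rewrite exprS -mulrA; apply: PM.
exists (f * (s ^+ m * g + c)), (f * d), (g * a + s * c), (g * b + s * d).
split; [|by apply/PM/PD|exact: PM|by apply: PD; apply: PM|by apply: PD; apply: PM].
rewrite exprS IH -mulmxE mul_companion_block.
by rewrite [s * (_ + _)]mulrDr [s * (_ * g)]mulrA -exprS addrCA.
Qed.

(** The path f s^m g contributes to the trace; [P] serves to record that
    the other paths contribute a sum of products of f, s, g without signs. *)
Lemma companion_trace m : exists2 r, P r & \tr (C ^+ m.+2) = f * s ^+ m * g + r.
Proof.
have [a [b [c [d [E Pa Pb Pc Pd]]]]] := companion_powers m.
exists (f * c + (g * b + s * d)); first by apply: PD; [|apply: PD]; apply: PM.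
rewrite exprS E -mulmxE mul_companion_block mxtrace_block.
by rewrite !mxtrace_scalar !mulr1n [f * (_ + c)]mulrDr [f * (_ * g)]mulrA -addrA.
Qed.
End CompanionTrace.

(** * The two endomorphisms *)

Local Notation pi := (rq_pi S_relator).

Definition companion_lift : 'M[free_ring3]_(1 + 1) :=
  block_mx 0 free_f%:M free_g%:M free_s%:M.

Definition companion : 'M[Sring]_(1 + 1) :=
  block_mx 0 (pi free_f)%:M (pi free_g)%:M (pi free_s)%:M.

Lemma ch_companion :
  ch (End0_class companion) = ch (End0_class ((pi free_s)%:M : 'M[Sring]_1)).
Proof.
rewrite !chE; apply: char_class_schur => k.
have relator0 : pi (free_f * free_s ^+ k * free_g) = pi 0.
  by apply/rq_piP; rewrite subr0; apply: ideal_gen_in; exists k.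
move: relator0; rewrite !rmorphM rmorphXn scalar_mx_exp -!scalar_mxM => ->.
by rewrite !raddf0.
Qed.

Local Notation nneg := (monalgOver (Num.nneg : {pred int})).

Lemma nnegD (u v : free_ring3) : u \is a nneg -> v \is a nneg -> u + v \is a nneg.
Proof. exact: (proj2 (monalgOver_addr_closed _ _)). Qed.

Lemma nnegM (u v : free_ring3) : u \is a nneg -> v \is a nneg -> u * v \is a nneg.
Proof. exact: (proj2 (monalgOver_mulr_closed _ _)). Qed.

Lemma nneg_word (w : word) : (<< w >> : free_ring3) \is a nneg.
Proof. by rewrite monalgOverU nnegrE ler01 orbT. Qed.

Lemma nneg_letter i : letter i \is a nneg.
Proof. exact: nneg_word. Qed.

(** The word f s^m g occurs in the trace, and no negative coefficient can cancel
    its contribution. *)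
Lemma companion_lift_trace_gt0 m :
  0 < (tau_tr fsg_trace (companion_lift ^+ m.+2))`_m.+2.
Proof.
have nneg0 : (0 : free_ring3) \is a nneg by apply: monalgOver0.
have [r r_ge0 E] := companion_trace (P := fun u : free_ring3 => u \is a nneg)
  nneg0 nnegD nnegM (nneg_letter _ : free_f \is a nneg)
  (nneg_letter _ : free_s \is a nneg) (nneg_letter _ : free_g \is a nneg) m.
rewrite /tau_tr E (raddfD fsg_trace) coefD ltr_pwDl ?fsg_trace_ge0 //.
rewrite relatorE fsg_trace_word /cyclic_weight asboolT; last first.
  by exists 0%N, m; rewrite rot0 /fsg_word cats1.
by rewrite /= size_cat size_nseq addn1 coefXn eqxx.
Qed.

Theorem proposition1p1 : ~ injective (@ch Sring : End0 Sring -> K1 (pseries Sring)).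
Proof.
move=> ch_inj; have /ch_inj := ch_companion.
move=> /(End0_class_trace fsg_traceC fsg_trace_relator_bounded) h.
have hs : bounded_degree (quot_trace fsg_trace ((pi free_s)%:M : 'M[Sring]_1)).
  have h0 := power_trace_lift fsg_traceC fsg_trace_relator_bounded
      (map_scalar_mx pi 1 free_s : map_mx pi (free_s%:M : 'M_1) = _).
  rewrite (_ : power_trace _ _ = 0) ?subr0 // in h0.
  apply: pseriesP => k /=.
  by rewrite /tau_tr scalar_mx_exp mxtrace_scalar fsg_trace_s.
have ha : bounded_degree
    (quot_trace fsg_trace companion - power_trace fsg_trace companion_lift).
  apply: (power_trace_lift fsg_traceC fsg_trace_relator_bounded).
  by rewrite map_block_mx map_mx0 !map_scalar_mx.
have [N hN] : bounded_degree (power_trace fsg_trace companion_lift).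
  have := bounded_degreeB (bounded_degreeD h hs) ha.
  by rewrite subrK opprB addrC subrK.
(* For the exponent N + 2 the degree is less than N, but also at least N + 2. *)
have := companion_lift_trace_gt0 N.
by rewrite nth_default ?ltxx // (leq_trans (hN N.+1)) // ltnW.
Qed.
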